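(* If there exists a $\sigma$-approximation algorithm for the closest substring problem, then there exists an approximation algorithm for Reopt-CSP$_{\mathcal{M}_{l+1}}$ which, on input $\mathcal{S}$ and an optimal $l$-length closest substring $v_{opt}$, outputs an $(l+1)$-length string $v'_{sol}$ with $$\mathrm{cost}(v'_{sol})\le \frac{2\sigma-1}{\sigma}\,\mathrm{cost}(v'_{opt})+\frac{\sigma-1}{\sigma}(t-1),$$ where $v'_{opt}$ is an optimal $(l+1)$-length closest substring of $\mathcal{S}$.
   Context: For strings $u,w$ of equal length, $d(u,w)$ is the Hamming distance. Let $\mathcal{S}=\{S_1,\dots,S_t\}$ be sequences over a finite alphabet $\Sigma$, each of length $n$. For $v\in\Sigma^m$, $\mathrm{cost}(v)=\sum_{i=1}^t\min\{d(v,y): y\text{ an } m\text{-length substring of } S_i\}$; an optimal $m$-length closest substring minimizes this over $\Sigma^m$. The closest substring problem (CSP): given $\mathcal{S}$ and $m$, find $v\in\Sigma^m$ minimizing $\mathrm{cost}(v)$. A $\sigma$-approximation algorithm for CSP ($\sigma\ge1$) outputs $v\in\Sigma^m$ with $\mathrm{cost}(v)\le\sigma$ times the optimum. Reopt-CSP$_{\mathcal{M}_{l+1}}$: given $\mathcal{S}$ and an optimal $l$-length closest substring $v_{opt}$ of $\mathcal{S}$, find an $(l+1)$-length closest substring. *)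

(* Defs.v *)
From mathcomp Require Import all_boot all_order all_algebra.
From mathcomp Require Import reals.

Set Implicit Arguments.
Unset Strict Implicit.
Unset Printing Implicit Defensive.

Import Order.TTheory GRing.Theory Num.Theory.

Section ClosestSubstring.
Variable Sigma : finType.

Definition hamming (m : nat) (u w : m.-tuple Sigma) : nat :=
  #|[set i : 'I_m | tnth u i != tnth w i]|.

(* [infix] is contiguous containment.  Hamming distances between strings of
   length m are at most m, so the default value m does not affect the minimum
   as soon as s has a substring of length m, i.e. m <= n. *)
Definition dist_to_substrings (m n : nat) (v : m.-tuple Sigma)
    (s : n.-tuple Sigma) : nat :=
  \big[minn/m]_(y : m.-tuple Sigma | infix y s) hamming v y.

Definition cost (t n m : nat) (Ss : t.-tuple (n.-tuple Sigma))
    (v : m.-tuple Sigma) : nat :=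
  (\sum_(i < t) dist_to_substrings v (tnth Ss i))%N.

Definition optimal_closest_substring (t n m : nat)
    (Ss : t.-tuple (n.-tuple Sigma)) (v : m.-tuple Sigma) : Prop :=
  forall w : m.-tuple Sigma, (cost Ss v <= cost Ss w)%N.

End ClosestSubstring.

(* An approximation algorithm is a polynomial-time algorithm: without a time
   bound, exhaustive search would always be one.  The model of computation is
   the WHILE language over binary trees of N. D. Jones (Computability and
   Complexity from a Programming Perspective), whose polynomial-time functions
   are the usual ones.  Expressions are charged one unit per syntax node;
   there is no unit-cost equality test on trees. *)

Inductive tree : Type := Nil | Cons of tree & tree.

Fixpoint tree_size (x : tree) : nat :=
  if x is Cons a b then (tree_size a + tree_size b).+1 else 1.

Definition tree_hd (x : tree) : tree := if x is Cons a _ then a else Nil.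
Definition tree_tl (x : tree) : tree := if x is Cons _ b then b else Nil.

Inductive expr : Type :=
  | EVar of nat
  | ENil
  | ECons of expr & expr
  | EHd of expr
  | ETl of expr.

Inductive cmd : Type :=
  | Skip
  | Assign of nat & expr
  | Seq of cmd & cmd
  | If of expr & cmd & cmd
  | While of expr & cmd.

Definition store : Type := nat -> tree.

Definition update (st : store) (x : nat) (v : tree) : store :=
  fun y => if y == x then v else st y.

Fixpoint eval (st : store) (e : expr) : tree :=
  match e with
  | EVar x => st x
  | ENil => Nil
  | ECons e1 e2 => Cons (eval st e1) (eval st e2)
  | EHd e1 => tree_hd (eval st e1)
  | ETl e1 => tree_tl (eval st e1)
  end.

Fixpoint eval_time (e : expr) : nat :=
  match e with
  | EVar _ | ENil => 1
  | ECons e1 e2 => (eval_time e1 + eval_time e2).+1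
  | EHd e1 | ETl e1 => (eval_time e1).+1
  end.

(* [exec c st k st']: started in store st, the command c halts after exactly
   k time units in store st'.  As a truth value, Nil is false and every other
   tree is true. *)
Inductive exec : cmd -> store -> nat -> store -> Prop :=
  | ExecSkip st : exec Skip st 1 st
  | ExecAssign st x e :
      exec (Assign x e) st (eval_time e).+1 (update st x (eval st e))
  | ExecSeq st1 st2 st3 c1 c2 k1 k2 :
      exec c1 st1 k1 st2 -> exec c2 st2 k2 st3 ->
      exec (Seq c1 c2) st1 (k1 + k2).+1 st3
  | ExecIfTrue st st' e c1 c2 k :
      eval st e <> Nil -> exec c1 st k st' ->
      exec (If e c1 c2) st (eval_time e + k).+1 st'
  | ExecIfFalse st st' e c1 c2 k :
      eval st e = Nil -> exec c2 st k st' ->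
      exec (If e c1 c2) st (eval_time e + k).+1 st'
  | ExecWhileTrue st1 st2 st3 e c k1 k2 :
      eval st1 e <> Nil -> exec c st1 k1 st2 ->
      exec (While e c) st2 k2 st3 ->
      exec (While e c) st1 (eval_time e + k1 + k2).+1 st3
  | ExecWhileFalse st e c :
      eval st e = Nil -> exec (While e c) st (eval_time e).+1 st.

(* Variable 0 holds the input at the start and the output at the end; all
   other variables initially hold Nil. *)
Definition init_store (x : tree) : store := update (fun=> Nil) 0 x.

Definition runs_in (p : cmd) (x : tree) (k : nat) (y : tree) : Prop :=
  exists2 st, exec p (init_store x) k st & st 0 = y.

Definition outputs (p : cmd) (x y : tree) : Prop := exists k, runs_in p x k y.

Definition poly_time_on (dom : tree -> Prop) (p : cmd) : Prop :=
  exists c d : nat, forall x, dom x ->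
    exists k y, runs_in p x k y /\ (k <= c * tree_size x ^ d)%N.

Section Encodings.
Variable Sigma : finType.

Definition enc_nat (n : nat) : tree := iter n (Cons Nil) Nil.

Definition enc_seq (T : Type) (enc : T -> tree) (s : seq T) : tree :=
  foldr (fun a => Cons (enc a)) Nil s.

Definition enc_symbol (a : Sigma) : tree := enc_nat (enum_rank a).

Definition enc_string (s : seq Sigma) : tree := enc_seq enc_symbol s.

Definition enc_family (t n : nat) (Ss : t.-tuple (n.-tuple Sigma)) : tree :=
  enc_seq (fun s : n.-tuple Sigma => enc_string s) Ss.

Definition csp_input (t n : nat) (Ss : t.-tuple (n.-tuple Sigma)) (m : nat) :
    tree :=
  Cons (enc_family Ss) (enc_nat m).

Definition is_csp_input (x : tree) : Prop :=
  exists (t n m : nat) (Ss : t.-tuple (n.-tuple Sigma)),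
    [/\ (0 < t)%N, (m <= n)%N & x = csp_input Ss m].

Definition reopt_input (t n l : nat) (Ss : t.-tuple (n.-tuple Sigma))
    (vopt : l.-tuple Sigma) : tree :=
  Cons (enc_family Ss) (enc_string vopt).

Definition is_reopt_input (x : tree) : Prop :=
  exists (t n l : nat) (Ss : t.-tuple (n.-tuple Sigma)) (vopt : l.-tuple Sigma),
    [/\ (0 < t)%N, (l.+1 <= n)%N, optimal_closest_substring Ss vopt
      & x = reopt_input Ss vopt].

End Encodings.

Definition csp_approx_algorithm (R : realType) (Sigma : finType) (sigma : R)
    (p : cmd) : Prop :=
  poly_time_on (@is_csp_input Sigma) p /\
  forall (t n m : nat) (Ss : t.-tuple (n.-tuple Sigma)),
    (0 < t)%N -> (m <= n)%N ->
    exists v : m.-tuple Sigma,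
      outputs p (csp_input Ss m) (enc_string v) /\
      forall vopt : m.-tuple Sigma, optimal_closest_substring Ss vopt ->
        ((cost Ss v)%:R <= sigma * (cost Ss vopt)%:R :> R)%R.

(* Main.v *)
Require Import Defs.
From mathcomp Require Import all_boot all_order all_algebra.
From mathcomp Require Import boolp reals zify ring lra.

Set Implicit Arguments.
Unset Strict Implicit.
Unset Printing Implicit Defensive.

Import Order.TTheory GRing.Theory Num.Theory.
(* Makes [Nil] and [Cons] denote the tree constructors again, not those of seq. *)
Import Defs.

(* If sigma = 1, the given algorithm is exact: it is run on the family with the
   length l + 1.  If sigma > 1, put alpha := (sigma - 1) / sigma, so that
   (2 sigma - 1) / sigma = 1 + alpha.  It then suffices to find a string of
   length l + 1 whose cost is at most 1 + alpha times the optimum, and this is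
   done by the sampling scheme of Li, Ma and Wang.  Let y_1, ..., y_t be the
   substrings closest to an optimal string; the columnwise plurality of r of the
   y_i, drawn independently and uniformly, has expected cost at most
   1 + O(|Sigma| / sqrt r) times the optimum (Chebyshev's inequality in every
   column).  For a constant r all r-tuples of substrings of the family can be
   tried in polynomial time.  The search tries all r-tuples of suffixes instead,
   which is the same because only the first l + 1 columns are read. *)

(** * Polynomial-time functions on trees *)

(** Polynomials with natural coefficients, generated syntactically so that monotonicity and closure
    under composition are inductions; [pbound_monomial] recovers the form [c * n ^ d] of
    [poly_time_on]. *)
Inductive pbound : (nat -> nat) -> Prop :=
  | pbound_const c : pbound (fun=> c)
  | pbound_id : pbound (fun n => n)
  | pbound_add f g : pbound f -> pbound g -> pbound (fun n => f n + g n)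
  | pbound_mul f g : pbound f -> pbound g -> pbound (fun n => f n * g n).

Lemma pbound_mono f m n : pbound f -> m <= n -> f m <= f n.
Proof.
by move=> pf mn; elim: pf => // g h _ IHg _ IHh; rewrite ?leq_add ?leq_mul.
Qed.

Lemma pbound_comp f g : pbound f -> pbound g -> pbound (fun n => f (g n)).
Proof.
move=> pf pg; elim: pf => [c||f1 f2 _ ? _ ?|f1 f2 _ ? _ ?] //.
- exact: pbound_const.
- exact: pbound_add.
- exact: pbound_mul.
Qed.

Lemma pboundS f : pbound f -> pbound (fun n => (f n).+1).
Proof.
move=> pf; rewrite -[fun n => _]/(fun n => 1 + f n).
by apply: pbound_add => //; apply: pbound_const.
Qed.

Lemma pbound_monomial f : pbound f ->
  exists c d : nat, forall n, 0 < n -> f n <= c * n ^ d.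
Proof.
elim=> [c||f1 f2 _ [c1 [d1 H1]] _ [c2 [d2 H2]]|
        f1 f2 _ [c1 [d1 H1]] _ [c2 [d2 H2]]].
- by exists c, 0 => n _; rewrite expn0 muln1.
- by exists 1, 1 => n _; rewrite expn1 mul1n.
- exists (c1 + c2), (d1 + d2) => n n0; rewrite mulnDl leq_add //.
  + apply: leq_trans (H1 _ n0) _.
    by rewrite leq_mul2l leq_pexp2l ?leq_addr ?orbT.
  + apply: leq_trans (H2 _ n0) _.
    by rewrite leq_mul2l leq_pexp2l ?leq_addl ?orbT.
- exists (c1 * c2), (d1 + d2) => n n0.
  by rewrite expnD mulnACA leq_mul ?H1 ?H2.
Qed.

Lemma tree_size_gt0 x : 0 < tree_size x.
Proof. by case: x. Qed.

Lemma tree_size_hd x : tree_size (tree_hd x) <= tree_size x.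
Proof. by case: x => //= a b; rewrite ltnW // ltnS leq_addr. Qed.

Lemma tree_size_tl x : tree_size (tree_tl x) <= tree_size x.
Proof. by case: x => //= a b; rewrite ltnW // ltnS leq_addl. Qed.

(* The program [c b] reads its argument from and leaves its result in variable
   b, using the variables above b as scratch space of arbitrary initial
   content.  The size of the result has to be bounded separately, since the
   trees of a store can share subtrees: k steps can build a tree of size 2^k. *)
Definition poly_fun (f : tree -> tree) : Prop :=
  exists (c : nat -> cmd) (B : nat -> nat), pbound B /\
    forall b st, exists k st',
      [/\ exec (c b) st k st', st' b = f (st b),
          forall x, x < b -> st' x = st x,
          k <= B (tree_size (st b)) & tree_size (f (st b)) <= B (tree_size (st b))].

Lemma poly_fun_size f : poly_fun f ->
  exists2 B, pbound B & forall x, tree_size (f x) <= B (tree_size x).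
Proof.
move=> [c [B [pB H]]]; exists B => // x.
by have [k [st' [_ _ _ _]]] := H 0 (fun=> x).
Qed.

Lemma poly_fun_program f : poly_fun f -> exists p : cmd,
  (forall dom, poly_time_on dom p) /\ forall x, outputs p x (f x).
Proof.
move=> [c [B [pB H]]]; exists (c 0); split=> [dom|x].
  have [c1 [d Hc]] := pbound_monomial pB; exists c1, d => x _.
  have [k [st' [He Hr _ Hk _]]] := H 0 (init_store x).
  exists k, (st' 0); split; first by exists st'.
  by apply: leq_trans Hk _; apply: Hc; apply: tree_size_gt0.
have [k [st' [He Hr _ _ _]]] := H 0 (init_store x).
by exists k, st'.
Qed.

Lemma update_same st x v : update st x v x = v.
Proof. by rewrite /update eqxx. Qed.

Lemma poly_fun_assign (e : nat -> expr) (f : tree -> tree) :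
  (forall b st, eval st (e b) = f (st b)) ->
  (forall b, eval_time (e b) = eval_time (e 0)) ->
  (forall x, tree_size (f x) <= (tree_size x).+1) -> poly_fun f.
Proof.
move=> He Ht Hs; exists (fun b => Assign b (e b)).
exists (fun n => (eval_time (e 0)).+1 + n.+1); split.
  apply: pbound_add; first exact: pbound_const.
  exact: pboundS pbound_id.
move=> b st; eexists; eexists; split.
- exact: ExecAssign.
- by rewrite /update eqxx.
- by move=> x xb; rewrite /update; case: eqP xb => // ->; rewrite ltnn.
- by rewrite Ht leq_addr.
- by apply: leq_trans (Hs _) _; rewrite leq_addl.
Qed.

Lemma poly_fun_id : poly_fun (fun x => x).
Proof. by apply: (@poly_fun_assign (fun b => EVar b) (fun x => x)). Qed.

Lemma poly_fun_nil : poly_fun (fun=> Nil).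
Proof. by apply: (@poly_fun_assign (fun=> ENil)) => // x /=; rewrite ltnS. Qed.

Lemma poly_fun_comp f g :
  poly_fun f -> poly_fun g -> poly_fun (fun x => f (g x)).
Proof.
move=> [cf [Bf [pf Hf]]] [cg [Bg [pg Hg]]].
exists (fun b => Seq (cg b) (cf b)), (fun n => (Bg n + Bf (Bg n)).+1); split.
  by apply/pboundS/pbound_add => //; apply: pbound_comp.
move=> b st.
have [k1 [st1 [E1 R1 F1 K1 S1]]] := Hg b st.
have [k2 [st2 [E2 R2 F2 K2 S2]]] := Hf b st1.
have mB : Bf (tree_size (st1 b)) <= Bf (Bg (tree_size (st b))).
  by apply: pbound_mono => //; rewrite R1.
exists (k1 + k2).+1, st2; split.
- exact: ExecSeq E1 E2.
- by rewrite R2 R1.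
- by move=> x xb; rewrite F2 // F1.
- by rewrite ltnS leq_add // (leq_trans K2).
- rewrite -R1; apply: leq_trans (leq_trans S2 mB) _.
  by rewrite -addnS -[X in X <= _]add0n leq_add.
Qed.

Lemma poly_fun_hd f : poly_fun f -> poly_fun (fun x => tree_hd (f x)).
Proof.
apply: poly_fun_comp; apply: (@poly_fun_assign (fun b => EHd (EVar b))) => // x.
by rewrite leqW // tree_size_hd.
Qed.

Lemma poly_fun_tl f : poly_fun f -> poly_fun (fun x => tree_tl (f x)).
Proof.
apply: poly_fun_comp; apply: (@poly_fun_assign (fun b => ETl (EVar b))) => // x.
by rewrite leqW // tree_size_tl.
Qed.

Ltac upd := rewrite /update /=; repeat (case: eqP => ?); try lia; try done.

Lemma poly_fun_cons f g :
  poly_fun f -> poly_fun g -> poly_fun (fun x => Cons (f x) (g x)).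
Proof.
move=> [cf [Bf [pf Hf]]] [cg [Bg [pg Hg]]].
(* The argument stays in [b] while [f] runs at [b.+1] and [g] at [b.+2], so that the result of [f]
   survives the run of [g]. *)
exists (fun b => Seq (Assign b.+1 (EVar b)) (Seq (cf b.+1)
  (Seq (Assign b.+2 (EVar b)) (Seq (cg b.+2)
     (Assign b (ECons (EVar b.+1) (EVar b.+2))))))).
exists (fun n => Bf n + Bg n + 12); split.
  by apply: pbound_add; [apply: pbound_add|apply: pbound_const].
move=> b st.
have [k1 [st1 [E1 R1 F1 K1 S1]]] := Hf b.+1 (update st b.+1 (st b)).
have [k2 [st2 [E2 R2 F2 K2 S2]]] := Hg b.+2 (update st1 b.+2 (st1 b)).
have e1 : st1 b = st b by rewrite F1 //; upd.
have fr x : x < b -> st2 x = st x.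
  move=> xb; transitivity (st1 x); first by rewrite F2 ?ltnS 1?ltnW //; upd.
  by rewrite F1 ?ltnS 1?ltnW //; upd.
move: R1 R2 K1 K2 S1 S2; rewrite !update_same => R1 R2 K1 K2 S1 S2.
have e2 : st2 b.+1 = f (st b) by rewrite F2 //; rewrite -R1; upd.
eexists; eexists; split.
- apply: ExecSeq; first exact: ExecAssign.
  apply: ExecSeq; first exact: E1.
  apply: ExecSeq; first exact: ExecAssign.
  apply: ExecSeq; first exact: E2.
  exact: ExecAssign.
- by rewrite {1}/update eqxx /= e2 R2 e1.
- by move=> x xb; rewrite -fr // {1}/update ltn_eqF.
- by move: K1 K2; rewrite e1 /=; lia.
- by move: S1 S2; rewrite e1 /=; lia.
Qed.

Definition tif (c a b : tree) : tree := if c is Nil then b else a.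

Lemma poly_fun_if c f g : poly_fun c -> poly_fun f -> poly_fun g ->
  poly_fun (fun x => tif (c x) (f x) (g x)).
Proof.
move=> [cc [Bc [pc Hc]]] [cf [Bf [pf Hf]]] [cg [Bg [pg Hg]]].
exists (fun b => Seq (Assign b.+1 (EVar b)) (Seq (cc b.+1)
  (If (EVar b.+1) (cf b) (cg b)))).
exists (fun n => Bc n + Bf n + Bg n + 12); split.
  by apply: pbound_add; [do 2?apply: pbound_add|apply: pbound_const].
move=> b st.
have [k1 [st1 [E1 R1 F1 K1 S1]]] := Hc b.+1 (update st b.+1 (st b)).
have e1 : st1 b = st b by rewrite F1 //; upd.
have fr x : x < b -> st1 x = st x.
  by move=> xb; rewrite F1 ?ltnS 1?ltnW //; upd.
move: R1 K1 S1; rewrite !update_same => R1 K1 S1.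
case Ec : (c (st b)) => [|u v].
- have [k2 [st2 [E2 R2 F2 K2 S2]]] := Hg b st1.
  eexists; exists st2; split.
  + apply: ExecSeq; first exact: ExecAssign.
    apply: ExecSeq; first exact: E1.
    by apply: ExecIfFalse E2; rewrite /= R1.
  + by rewrite R2 e1.
  + by move=> x xb; rewrite F2 // fr.
  + by move: K1 K2; rewrite e1 /=; lia.
  + by move: S2; rewrite e1 /=; lia.
- have [k2 [st2 [E2 R2 F2 K2 S2]]] := Hf b st1.
  eexists; exists st2; split.
  + apply: ExecSeq; first exact: ExecAssign.
    apply: ExecSeq; first exact: E1.
    by apply: ExecIfTrue E2; rewrite /= R1 Ec.
  + by rewrite R2 e1.
  + by move=> x xb; rewrite F2 // fr.
  + by move: K1 K2; rewrite e1 /=; lia.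
  + by move: S2; rewrite e1 /=; lia.
Qed.

(* The step function h receives the environment e, the not yet processed part
   of the list (whose head is the current element) and the accumulator. *)
Fixpoint tfoldl (h : tree -> tree -> tree -> tree) (e acc xs : tree) : tree :=
  if xs is Cons _ xs' then tfoldl h e (h e xs acc) xs' else acc.

(** A step that doubled its accumulator would make a fold exponential. An increment bounded
    independently of the accumulator keeps the whole fold polynomial. *)
Definition additive_growth (h : tree -> tree -> tree -> tree) : Prop :=
  exists2 Q, pbound Q & forall e xs acc,
    tree_size (h e xs acc) <= tree_size acc + Q (tree_size e + tree_size xs).

Lemma tfoldl_size h Q e acc xs : pbound Q ->
  (forall e xs acc,
    tree_size (h e xs acc) <= tree_size acc + Q (tree_size e + tree_size xs)) ->
  tree_size (tfoldl h e acc xs) <=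
    tree_size acc + tree_size xs * Q (tree_size e + tree_size xs).
Proof.
move=> pQ hQ; elim: xs acc => [|a _ xs IH] acc /=; first by rewrite leq_addr.
apply: leq_trans (IH _) _.
have Hh := hQ e (Cons a xs) acc.
rewrite /= in Hh *.
set n := (_ + (_ + _).+1) in Hh *.
have mQ : Q (tree_size e + tree_size xs) <= Q n.
  by apply: pbound_mono => //; rewrite /n; lia.
have m2 : tree_size xs * Q (tree_size e + tree_size xs) <= tree_size xs * Q n.
  by rewrite leq_mul2l mQ orbT.
by rewrite mulSn mulnDl; lia.
Qed.

Lemma additive_growth_fun h g : poly_fun (fun z => g (tree_hd z) (tree_tl z)) ->
  (forall e xs acc,
    tree_size (h e xs acc) <= tree_size acc + tree_size (g e xs)) ->
  additive_growth h.
Proof.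
move=> /poly_fun_size[B pB HB] H; exists (fun n => B n.+1).
  by apply: pbound_comp => //; apply: pboundS pbound_id.
move=> e xs acc; apply: leq_trans (H _ _ _) _.
by rewrite leq_add2l; apply: (HB (Cons e xs)).
Qed.

(** For nested loops: an inner fold that starts from the outer accumulator makes at most
    polynomially many additive increments. *)
Lemma additive_growth_fold h f g : additive_growth h ->
  poly_fun (fun z => f (tree_hd z) (tree_tl z)) ->
  poly_fun (fun z => g (tree_hd z) (tree_tl z)) ->
  additive_growth (fun e xs acc => tfoldl h (f e xs) acc (g e xs)).
Proof.
move=> [Q pQ HQ] /poly_fun_size[Bf pf Hf] /poly_fun_size[Bg pg Hg].
exists (fun n => Bg n.+1 * Q (Bf n.+1 + Bg n.+1)).
  have pS := pboundS pbound_id.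
  apply: pbound_mul; first exact: pbound_comp pg pS.
  apply: pbound_comp => //.
  by apply: pbound_add; apply: pbound_comp _ pS.
move=> e xs acc; apply: leq_trans (tfoldl_size _ _ _ pQ HQ) _.
have /= Hf1 := Hf (Cons e xs); have /= Hg1 := Hg (Cons e xs).
by rewrite leq_add2l leq_mul // pbound_mono // leq_add.
Qed.

Lemma poly_fun_fold h e i l :
  poly_fun (fun z => h (tree_hd z) (tree_hd (tree_tl z)) (tree_tl (tree_tl z))) ->
  additive_growth h -> poly_fun e -> poly_fun i -> poly_fun l ->
  poly_fun (fun x => tfoldl h (e x) (i x) (l x)).
Proof.
move=> [c [B [pB H]]] [Q pQ HQ] pe pi pl.
pose body b := Seq (Assign b.+3 (ECons (EVar b.+1) (ECons (EVar b.+2) (EVar b))))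
  (Seq (c b.+3) (Seq (Assign b (EVar b.+3)) (Assign b.+2 (ETl (EVar b.+2))))).
pose loop b := While (EVar b.+2) (body b).
(* [S] bounds the environment plus the remaining list, [M] the accumulator plus the growth still to
   come. Both bounds survive an iteration, so every argument of the step program has size at most
   [S + M + 2]. *)
have Hloop b E S M : forall st, st b.+1 = E ->
    tree_size E + tree_size (st b.+2) <= S ->
    tree_size (st b) + tree_size (st b.+2) * Q S <= M ->
    exists k st', [/\ exec (loop b) st k st',
      st' b = tfoldl h E (st b) (st b.+2),
      forall x, x < b -> st' x = st x &
      k <= tree_size (st b.+2) * (B (S + M).+2 + 20)].
  move=> st; move El : (st b.+2) => L.
  elim: L st El => [|a _ L IH] st El e1 hS hM.
    exists 2, st; split=> //; last by rewrite mul1n; lia.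
    exact: (@ExecWhileFalse st (EVar b.+2)).
  set st1 := update st b.+3 (Cons E (Cons (Cons a L) (st b))).
  have [k2 [st2 [E2 R2 F2 K2 _]]] := H b.+3 st1.
  have v3 : st1 b.+3 = Cons E (Cons (Cons a L) (st b)) by rewrite /st1; upd.
  rewrite v3 /= in R2 K2.
  have v0 : st2 b.+2 = Cons a L by rewrite F2 // -El /st1; upd.
  set st4 := update (update st2 b (st2 b.+3)) b.+2 L.
  have f0 : st4 b = h E (Cons a L) (st b) by rewrite /st4 -R2; upd.
  have f1 : st4 b.+1 = E.
    by rewrite -e1; transitivity (st2 b.+1);
       [rewrite /st4; upd | rewrite F2 // /st1; upd].
  have f2 : st4 b.+2 = L by rewrite /st4; upd.
  have fx x : x < b -> st4 x = st x.
    move=> xb; transitivity (st2 x); first by rewrite /st4; upd.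
    by rewrite F2; [rewrite /st1; upd | lia].
  have mQ : Q (tree_size E + tree_size (Cons a L)) <= Q S by apply: pbound_mono.
  have Hh := HQ E (Cons a L) (st b).
  rewrite /= in hS hM mQ Hh.
  have hM' : tree_size (st4 b) + tree_size L * Q S <= M.
    by rewrite f0; rewrite mulSn mulnDl in hM; lia.
  have hS' : tree_size E + tree_size L <= S by lia.
  have [k3 [st5 [E3 R3 F3 K3]]] := IH st4 f2 f1 hS' hM'.
  eexists; exists st5; split.
  - apply: ExecWhileTrue E3; first by rewrite /= El.
    apply: ExecSeq; first exact: ExecAssign.
    rewrite /= e1 El -/st1.
    apply: ExecSeq; first exact: E2.
    apply: ExecSeq; first exact: ExecAssign.
    have -> : st4 = update (update st2 b (eval st2 (EVar b.+3))) b.+2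
        (eval (update st2 b (eval st2 (EVar b.+3))) (ETl (EVar b.+2))).
      rewrite /st4 /= ; congr update.
      have -> : update st2 b (st2 b.+3) b.+2 = st2 b.+2 by upd.
      by rewrite v0.
    exact: ExecAssign.
  - by rewrite R3 f0.
  - by move=> x xb; rewrite F3 // fx.
  - have mB : k2 <= B (S + M).+2.
      by apply: leq_trans K2 _; apply: pbound_mono => //; lia.
    by move: K3; rewrite /= mulSn; nia.
apply: (@poly_fun_comp (fun z => tfoldl h (tree_hd z) (tree_hd (tree_tl z))
  (tree_tl (tree_tl z))) (fun x => Cons (e x) (Cons (i x) (l x)))); last first.
  by do 2?apply: poly_fun_cons.
(* Variable [b] is overwritten last, since environment and list are read off from it. *)
exists (fun b => Seq (Assign b.+1 (EHd (EVar b)))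
  (Seq (Assign b.+2 (ETl (ETl (EVar b))))
  (Seq (Assign b (EHd (ETl (EVar b)))) (loop b)))).
pose S n := n + n; pose M n := n + n * Q (S n).
have pS : pbound S by apply: pbound_add; apply: pbound_id.
have pM : pbound M.
  apply: pbound_add; first exact: pbound_id.
  by apply: pbound_mul; [exact: pbound_id | exact: pbound_comp].
exists (fun n => n * (B (S n + M n).+2 + 20) + 20 + M n); split.
  apply: pbound_add => //; apply: pbound_add; last exact: pbound_const.
  apply: pbound_mul; first exact: pbound_id.
  apply: pbound_add; last exact: pbound_const.
  by apply: pbound_comp => //; apply/pboundS/pboundS/pbound_add.
move=> b st; set z := st b.
set n := tree_size z.
pose st1 := update st b.+1 (tree_hd z).
pose st2 := update st1 b.+2 (tree_tl (tree_tl z)).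
pose st3 := update st2 b (tree_hd (tree_tl z)).
have z1 : st1 b = z by rewrite /st1; upd.
have z2 : st2 b = z by rewrite /st2 -z1; upd.
have w0 : st3 b = tree_hd (tree_tl z) by rewrite /st3; upd.
have w1 : st3 b.+1 = tree_hd z by rewrite /st3 /st2 /st1; upd.
have w2 : st3 b.+2 = tree_tl (tree_tl z) by rewrite /st3 /st2 /st1; upd.
have s0 := leq_trans (tree_size_hd (tree_tl z)) (tree_size_tl z).
have s1 := tree_size_hd z.
have s2 := leq_trans (tree_size_tl (tree_tl z)) (tree_size_tl z).
rewrite -/n in s0 s1 s2.
have hS : tree_size (tree_hd z) + tree_size (st3 b.+2) <= S n by rewrite w2 leq_add.
have hM : tree_size (st3 b) + tree_size (st3 b.+2) * Q (S n) <= M n.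
  by rewrite w0 w2 leq_add // leq_mul.
have [k [st' [E1 R1 F1 K1]]] := Hloop b _ _ _ _ w1 hS hM.
eexists; exists st'; split.
- apply: ExecSeq; first exact: ExecAssign.
  rewrite /= -/z -/st1; apply: ExecSeq; first exact: ExecAssign.
  rewrite /= z1 -/st2; apply: ExecSeq; first exact: ExecAssign.
  by rewrite /= z2 -/st3; exact: E1.
- by rewrite R1 w0 w2.
- by move=> x xb; rewrite F1 // /st3 /st2 /st1; upd.
- rewrite /= w2 in K1 *.
  have : tree_size (tree_tl (tree_tl z)) * (B (S n + M n).+2 + 20)
     <= n * (B (S n + M n).+2 + 20) by rewrite leq_mul.
  lia.
- apply: leq_trans (tfoldl_size _ _ _ pQ HQ) _.
  apply: leq_trans (leq_addl _ (M n)); apply: leq_add => //; apply: leq_mul => //.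
  by apply: pbound_mono => //; apply: leq_add.
Qed.

(** * The sampling algorithm *)

Create HintDb poly.
#[local] Hint Resolve poly_fun_nil poly_fun_id poly_fun_cons poly_fun_hd poly_fun_tl
  poly_fun_if : poly.

Ltac poly := cbv beta; auto 40 with poly.

(** Truncated subtraction on unary numbers, and on encoded lists the removal of as many entries as
    [b] has. As a test it is true exactly when [a] has the longer right spine. *)
Definition tsub (a b : tree) : tree :=
  tfoldl (fun _ _ acc => tree_tl acc) Nil a b.

Definition tadd (a b : tree) : tree :=
  tfoldl (fun _ _ acc => Cons Nil acc) Nil a b.

Definition tneq (a b : tree) : tree := tif (tsub a b) (tsub a b) (tsub b a).

Definition tmin (a b : tree) : tree := tif (tsub a b) b a.

(** The accumulator pairs the unread part of [w] with the mismatch count. Reading stops at the end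
    of [u], so a suffix can stand for the substring at its start. *)
Definition thamming (u w : tree) : tree :=
  tree_tl (tfoldl (fun _ xs acc => Cons (tree_tl (tree_hd acc))
    (tif (tneq (tree_hd xs) (tree_hd (tree_hd acc)))
       (Cons Nil (tree_tl acc)) (tree_tl acc))) Nil (Cons w Nil) u).

(** The initial value [u], read in unary, is its own length, the default value in
    [dist_to_substrings]. Suffixes shorter than [u] are skipped. *)
Definition tdist (u s : tree) : tree :=
  tfoldl (fun e xs acc => tif (tsub e xs) acc (tmin acc (thamming e xs))) u u s.

Definition tcost (F u : tree) : tree :=
  tfoldl (fun e xs acc => tadd acc (tdist e (tree_hd xs))) u Nil F.

Definition tsuffixes (F : tree) : tree :=
  tfoldl (fun _ ss acc => tfoldl (fun _ xs acc => Cons xs acc) Nil acc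
    (tree_hd ss)) Nil Nil F.

Definition tcount (a col : tree) : tree :=
  tfoldl (fun e xs acc => tif (tneq e (tree_hd xs)) acc (Cons Nil acc)) a Nil col.

Definition tplurality (col : tree) : tree :=
  tfoldl (fun e xs acc =>
    tif (tsub (tcount (tree_hd xs) e) (tcount acc e)) (tree_hd xs) acc)
  col (tree_hd col) col.

Definition tcolumn (c x : tree) : tree :=
  tfoldl (fun e xs acc => Cons (tree_hd (tsub (tree_hd xs) e)) acc) c Nil x.

(** [c] serves as a counter: the tails of its unread parts have lengths m - 1, ..., 0, and
    prepending the columns in this order yields the string from left to right. *)
Definition tconsensus (c x : tree) : tree :=
  tfoldl (fun e xs acc => Cons (tplurality (tcolumn (tree_tl xs) e)) acc) x Nil c.

(* [ctx] packs the family, the list of its suffixes and a list whose length is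
   that of the strings to be produced; [x] is the sample collected so far, which
   is completed by k further suffixes in the best possible way. *)
Fixpoint tsearch (k : nat) (ctx x : tree) : tree :=
  if k is k'.+1 then
    tfoldl (fun e xs acc =>
      tif (tsub (tcost (tree_hd (tree_hd e)) acc)
                (tcost (tree_hd (tree_hd e))
                   (tsearch k' (tree_hd e) (Cons (tree_hd xs) (tree_tl e)))))
          (tsearch k' (tree_hd e) (Cons (tree_hd xs) (tree_tl e))) acc)
      (Cons ctx x) (tsearch k' ctx x) (tree_hd (tree_tl ctx))
  else tconsensus (tree_tl (tree_tl ctx)) x.

(** [Cons Nil (tree_tl x)] has one entry more than the given string, hence length l + 1. *)
Definition tptas (r : nat) (x : tree) : tree :=
  tsearch r (Cons (tree_hd x) (Cons (tsuffixes (tree_hd x)) (Cons Nil (tree_tl x))))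
    Nil.

(** * Polynomial running time of the search *)

Lemma poly_tsub f g :
  poly_fun f -> poly_fun g -> poly_fun (fun x => tsub (f x) (g x)).
Proof.
move=> pf pg; apply: poly_fun_fold => //; first by poly.
  apply: (@additive_growth_fun _ (fun _ _ => Nil)); first by poly.
  by move=> e xs acc; rewrite (leq_trans (tree_size_tl _)) ?leq_addr.
by poly.
Qed.
#[local] Hint Resolve poly_tsub : poly.

Lemma tadd_growth : additive_growth (fun _ _ acc => Cons Nil acc).
Proof.
apply: (@additive_growth_fun _ (fun _ _ => Cons Nil Nil)); first by poly.
by move=> e xs acc /=; lia.
Qed.

Lemma poly_tadd f g :
  poly_fun f -> poly_fun g -> poly_fun (fun x => tadd (f x) (g x)).
Proof.
move=> pf pg; apply: poly_fun_fold => //; first by poly.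
  exact: tadd_growth.
by poly.
Qed.
#[local] Hint Resolve poly_tadd : poly.

Lemma poly_tneq f g :
  poly_fun f -> poly_fun g -> poly_fun (fun x => tneq (f x) (g x)).
Proof. by move=> pf pg; rewrite /tneq; poly. Qed.
#[local] Hint Resolve poly_tneq : poly.

Lemma poly_tmin f g :
  poly_fun f -> poly_fun g -> poly_fun (fun x => tmin (f x) (g x)).
Proof. by move=> pf pg; rewrite /tmin; poly. Qed.
#[local] Hint Resolve poly_tmin : poly.

Lemma tree_size_if c a b : tree_size (tif c a b) <= maxn (tree_size a) (tree_size b).
Proof. by case: c => [|? ?]; rewrite leq_max leqnn ?orbT. Qed.

Lemma poly_thamming f g :
  poly_fun f -> poly_fun g -> poly_fun (fun x => thamming (f x) (g x)).
Proof.
move=> pf pg; apply/poly_fun_tl/poly_fun_fold; try by poly.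
apply: (@additive_growth_fun _ (fun _ _ => Cons Nil (Cons Nil Nil))); first by poly.
move=> e xs acc /=; move: (tneq _ _) => c.
have := tree_size_if c (Cons Nil (tree_tl acc)) (tree_tl acc).
have := tree_size_tl (tree_hd acc).
by case: acc => [|a b] /=; lia.
Qed.
#[local] Hint Resolve poly_thamming : poly.

Lemma poly_tdist f g :
  poly_fun f -> poly_fun g -> poly_fun (fun x => tdist (f x) (g x)).
Proof.
move=> pf pg; apply/poly_fun_fold; try by poly.
apply: (@additive_growth_fun _ (fun e xs => thamming e xs)); first by poly.
move=> e xs acc; rewrite /tmin.
have := tree_size_if (tsub acc (thamming e xs)) (thamming e xs) acc.
by case: (tsub e xs) => [|? ?] /=; lia.
Qed.
#[local] Hint Resolve poly_tdist : poly.

Lemma poly_tcost f g :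
  poly_fun f -> poly_fun g -> poly_fun (fun x => tcost (f x) (g x)).
Proof.
move=> pf pg; apply/poly_fun_fold; try by poly.
apply: (@additive_growth_fold _ (fun _ _ => Nil)
  (fun e xs => tdist e (tree_hd xs))); try by poly.
exact: tadd_growth.
Qed.
#[local] Hint Resolve poly_tcost : poly.

Lemma poly_tsuffixes f : poly_fun f -> poly_fun (fun x => tsuffixes (f x)).
Proof.
have gr : additive_growth (fun _ xs acc => Cons xs acc).
  apply: (@additive_growth_fun _ (fun _ xs => Cons Nil xs)); first by poly.
  by move=> e xs acc /=; lia.
move=> pf; apply/poly_fun_fold; try by poly.
  by apply: poly_fun_fold => //; poly.
by apply: (@additive_growth_fold _ (fun _ _ => Nil) (fun _ xs => tree_hd xs)) => //;
   poly.
Qed.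
#[local] Hint Resolve poly_tsuffixes : poly.

Lemma poly_tcount f g :
  poly_fun f -> poly_fun g -> poly_fun (fun x => tcount (f x) (g x)).
Proof.
move=> pf pg; apply/poly_fun_fold; try by poly.
apply: (@additive_growth_fun _ (fun e xs => Cons Nil Nil)); first by poly.
by move=> e xs acc; case: (tneq _ _) => [|? ?] /=; lia.
Qed.
#[local] Hint Resolve poly_tcount : poly.

Lemma poly_tplurality f : poly_fun f -> poly_fun (fun x => tplurality (f x)).
Proof.
move=> pf; apply/poly_fun_fold; try by poly.
apply: (@additive_growth_fun _ (fun e xs => tree_hd xs)); first by poly.
by move=> e xs acc; case: (tsub _ _) => [|? ?] /=; lia.
Qed.
#[local] Hint Resolve poly_tplurality : poly.

Lemma poly_tcolumn f g :
  poly_fun f -> poly_fun g -> poly_fun (fun x => tcolumn (f x) (g x)).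
Proof.
move=> pf pg; apply/poly_fun_fold; try by poly.
apply: (@additive_growth_fun _
  (fun e xs => Cons (tree_hd (tsub (tree_hd xs) e)) Nil)); first by poly.
by move=> e xs acc /=; lia.
Qed.
#[local] Hint Resolve poly_tcolumn : poly.

Lemma poly_tconsensus f g :
  poly_fun f -> poly_fun g -> poly_fun (fun x => tconsensus (f x) (g x)).
Proof.
move=> pf pg; apply/poly_fun_fold; try by poly.
apply: (@additive_growth_fun _
  (fun e xs => Cons (tplurality (tcolumn (tree_tl xs) e)) Nil)); first by poly.
by move=> e xs acc /=; lia.
Qed.
#[local] Hint Resolve poly_tconsensus : poly.

(** For fixed depth [k] the fold rule is applied once per level. A step keeps the accumulator or
    replaces it by a tree computed from environment and list alone, so growth is additive. *)
Lemma poly_tsearch k f g :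
  poly_fun f -> poly_fun g -> poly_fun (fun x => tsearch k (f x) (g x)).
Proof.
elim: k f g => [|k IH] f g pf pg; first by rewrite /tsearch; poly.
apply/poly_fun_fold; try by poly.
apply: (@additive_growth_fun _
  (fun e xs => tsearch k (tree_hd e) (Cons (tree_hd xs) (tree_tl e)))).
  by poly.
move=> e xs acc; rewrite -/tsearch; move: (tsearch k _ _) => y.
by case: (tsub _ _) => [|? ?]; rewrite ?leq_addr ?leq_addl.
Qed.

Lemma poly_tptas r : poly_fun (tptas r).
Proof. by apply: poly_tsearch; poly. Qed.

(** * Correctness of the tree programs on encoded data *)

Fixpoint tlen (x : tree) : nat := if x is Cons _ y then (tlen y).+1 else 0.

Lemma tifE c a b : tif c a b = if tlen c == 0 then b else a.
Proof. by case: c. Qed.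

Lemma tlen_tsub a b : tlen (tsub a b) = tlen a - tlen b.
Proof.
rewrite /tsub; elim: b a => [|? _ b IH] a /=; first by rewrite subn0.
by rewrite IH; case: a => //= ? a; rewrite subSS.
Qed.

Lemma tlen_tadd a b : tlen (tadd a b) = tlen a + tlen b.
Proof.
rewrite /tadd; elim: b a => [|? _ b IH] a /=; first by rewrite addn0.
by rewrite IH /= addnS.
Qed.

Lemma tlen_tneq a b : (tlen (tneq a b) == 0) = (tlen a == tlen b).
Proof.
rewrite /tneq tifE fun_if !tlen_tsub; case: ifP => [/eqP|]; lia.
Qed.

Lemma tlen_tmin a b : tlen (tmin a b) = minn (tlen a) (tlen b).
Proof. by rewrite /tmin tifE fun_if tlen_tsub; case: ifP => [/eqP|]; lia. Qed.

Lemma tlen_enc_nat n : tlen (enc_nat n) = n.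
Proof. by elim: n => //= n ->. Qed.

Lemma dist_to_substrings_le (Sigma : finType) m n (u y : m.-tuple Sigma)
    (s : n.-tuple Sigma) :
  infix y s -> dist_to_substrings u s <= hamming u y.
Proof.
rewrite /dist_to_substrings => yi.
elim: (index_enum _) (mem_index_enum y) => //= z r IH.
rewrite inE big_cons => /orP[/eqP<-|/IH{}IH]; first by rewrite yi geq_minl.
by case: ifP => // _; rewrite geq_min IH orbT.
Qed.

Section Encoded.
Variable Sigma : finType.
Variable a0 : Sigma.
(** The head of the empty list is [Nil], the code of the symbol of rank 0; with this default symbol
    [tree_hd] agrees with [head] on all encoded strings. *)
Hypothesis a0_rank : enum_rank a0 = 0 :> nat.

Notation es := (@enc_symbol Sigma).
Notation estr := (@enc_string Sigma).
Notation efam := (enc_seq estr).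

Lemma enc_a0 : es a0 = Nil.
Proof. by rewrite /enc_symbol a0_rank. Qed.

Lemma tlen_enc_seq (T : Type) (enc : T -> tree) s : tlen (enc_seq enc s) = size s.
Proof. by elim: s => //= a s ->. Qed.

Lemma tlen_tneq_symbol a b : (tlen (tneq (es a) (es b)) == 0) = (a == b).
Proof.
rewrite tlen_tneq !tlen_enc_nat; apply/eqP/eqP => [|->//].
by move=> /val_inj/enum_rank_inj.
Qed.

Lemma tsub_enc_seq (T : Type) (enc : T -> tree) s c :
  tsub (enc_seq enc s) c = enc_seq enc (drop (tlen c) s).
Proof.
rewrite /tsub; elim: c s => [|? _ c IH] s /=; first by rewrite drop0.
by case: s => [|a s] /=; rewrite -?IH //= -[Nil]/(enc_seq enc [::]) IH.
Qed.

Lemma hd_enc_string w : tree_hd (estr w) = es (head a0 w).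
Proof. by case: w => //=; rewrite enc_a0. Qed.

Lemma tl_enc_string w : tree_tl (estr w) = estr (behead w).
Proof. by case: w. Qed.

Lemma tfoldl_enc_seq (T U : Type) (enc : T -> tree) (enc' : U -> tree) h e g s z :
  (forall a xs y, h e (Cons (enc a) xs) (enc' y) = enc' (g y a)) ->
  tfoldl h e (enc' z) (enc_seq enc s) = enc' (foldl g z s).
Proof. by move=> H; elim: s z => //= a s IH z; rewrite H IH. Qed.

Definition mismatches (u w : seq Sigma) : nat :=
  \sum_(j < size u) (nth a0 u j != nth a0 w j).

Lemma mismatches_cons a u w :
  mismatches (a :: u) w = (a != head a0 w) + mismatches u (behead w).
Proof.
rewrite /mismatches big_ord_recl /= nth0; congr addn.
by apply: eq_bigr => j _; rewrite nth_behead.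
Qed.

Lemma tlen_thamming u w : tlen (thamming (estr u) (estr w)) = mismatches u w.
Proof.
rewrite /thamming; set h := fun _ _ _ => _.
suff H acc : tlen (tree_tl (tfoldl h Nil (Cons (estr w) acc) (estr u))) =
    mismatches u w + tlen acc by rewrite H addn0.
elim: u w acc => [|a u IH] w acc; first by rewrite /mismatches big_ord0.
rewrite /= {2}/h /= tl_enc_string hd_enc_string tifE tlen_tneq_symbol IH.
by rewrite mismatches_cons fun_if /=; case: eqP => /=; lia.
Qed.

Lemma hamming_mismatches m (u : m.-tuple Sigma) (y : m.-tuple Sigma) w :
  prefix y w -> hamming u y = mismatches u w.
Proof.
move=> /prefixP[w' ->]; rewrite /hamming /mismatches -sum1_card size_tuple.
rewrite big_mkcond; apply: eq_bigr => j _.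
rewrite inE nth_cat size_tuple ltn_ord !(tnth_nth a0).
by case: eqP.
Qed.

Fixpoint suffixes (s : seq Sigma) : seq (seq Sigma) :=
  if s is _ :: s' then s :: suffixes s' else [::].

Lemma mem_suffixes s w : (w \in suffixes s) = (w != [::]) && suffix w s.
Proof.
elim: s w => [|a s IH] w /=; first by rewrite suffixs0 andNb.
rewrite inE IH; case: (w =P a :: s) => [->|/eqP ne] /=; first by rewrite suffix_refl.
case: w ne => //= b w ne; apply/idP/idP => /suffixP[s'].
  by move=> ->; rewrite -cat_cons suffix_suffix.
case: s' => [|c s'] /=; first by move=> E; rewrite E eqxx in ne.
by case=> _ ->; rewrite suffix_suffix.
Qed.

(** Both sides are minima and are compared through their lower bounds [k]. The substrings of length
    m are the prefixes of length m of the suffixes that are long enough; these are non-empty because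
    m > 0. *)
Lemma tlen_tdist m (u : m.-tuple Sigma) n (s : n.-tuple Sigma) : 0 < m ->
  tlen (tdist (estr u) (estr s)) = dist_to_substrings u s.
Proof.
move=> m0; rewrite /tdist; set h := fun _ _ _ => _.
have lower k (x : seq Sigma) acc :
  (k <= tlen (tfoldl h (estr u) acc (estr x))) =
  (k <= tlen acc) && all (fun w => (m <= size w) ==> (k <= mismatches u w))
    (suffixes x).
  elim: x acc => [|a x IH] acc; first by rewrite andbT.
  rewrite /= IH /= {1}/h -[Cons (es a) _]/(estr (a :: x)) tifE tlen_tsub !tlen_enc_seq size_tuple.
  rewrite subn_eq0 fun_if tlen_tmin tlen_thamming andbA; congr (_ && _).
  by case: ifP => _ /=; rewrite ?andbT // leq_min.
have bigmin k : (k <= dist_to_substrings u s) =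
  (k <= m) && [forall y : m.-tuple Sigma, infix y s ==> (k <= hamming u y)].
  rewrite /dist_to_substrings; apply/idP/andP => [H|[km /forallP H]].
    split; last first.
      apply/forallP => y; apply/implyP => yi; apply: leq_trans H _.
      exact: dist_to_substrings_le.
    apply: leq_trans H _.
    by elim/big_rec: _ => // y z _ zm; rewrite geq_min zm orbT.
  elim/big_ind: _ => // [y z|y yi]; first by rewrite leq_min => -> ->.
  by apply: (implyP (H y)).
suff E k : (k <= tlen (tfoldl h (estr u) (estr u) (estr s))) =
    (k <= dist_to_substrings u s).
  by apply/eqP; rewrite eqn_leq -E leqnn E leqnn.
rewrite lower bigmin tlen_enc_seq size_tuple; congr (_ && _).
apply/allP/forallP => [H y|H w].
  apply/implyP => /infixP[s1 [s2 Es]].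
  have pw : prefix y (y ++ s2) by rewrite prefix_prefix.
  rewrite (hamming_mismatches _ pw).
  apply: (implyP (H (y ++ s2) _)); last by rewrite size_cat size_tuple leq_addr.
  rewrite mem_suffixes Es suffix_suffix andbT -size_eq0 size_cat size_tuple.
  by rewrite addn_eq0 negb_and -lt0n m0.
rewrite mem_suffixes => /andP[_ sw]; apply/implyP => mw.
have st : size (take m w) == m by rewrite size_take_min (minn_idPl mw).
have pw : prefix (Tuple st) w by rewrite /= prefix_take.
rewrite -(hamming_mismatches _ pw); apply: (implyP (H _)) => /=.
by apply: infix_trans (suffixW sw); apply: prefixW; rewrite prefix_take.
Qed.

Lemma tlen_tcost t n m (Ss : t.-tuple (n.-tuple Sigma)) (u : m.-tuple Sigma) :
  0 < m -> tlen (tcost (enc_family Ss) (estr u)) = cost Ss u.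
Proof.
move=> m0; rewrite /tcost /enc_family /cost.
transitivity (\sum_(s <- Ss) dist_to_substrings u s); last first.
  by rewrite big_tuple.
rewrite -[RHS]add0n -[X in X + _]/(tlen Nil).
elim: (tval Ss) Nil => [|s ss IH] acc /=; first by rewrite big_nil addn0.
by rewrite IH tlen_tadd tlen_tdist // big_cons addnA.
Qed.

Lemma tsuffixes_enc t n (Ss : t.-tuple (n.-tuple Sigma)) :
  exists2 W, tsuffixes (enc_family Ss) = efam W &
    forall i w, w \in suffixes (tnth Ss i) -> w \in W.
Proof.
pose W0 := foldl (fun acc (s : n.-tuple Sigma) => rev (suffixes s) ++ acc) [::] Ss.
exists W0.
  rewrite /tsuffixes -[X in tfoldl _ _ X]/(efam [::]).
  apply: tfoldl_enc_seq => s _ acc /=.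
  elim: (tval s) acc => //= a x IH acc.
  by rewrite -[Cons (es a) _]/(estr (a :: x)) -[Cons _ _]/(efam ((a :: x) :: acc)) IH
             rev_cons cat_rcons.
move=> i w; rewrite /W0.
have : tnth Ss i \in tval Ss by apply: mem_tnth.
move: (tnth Ss i) => si.
elim/last_ind: (tval Ss) => // ss s IH.
rewrite mem_rcons inE foldl_rcons mem_cat mem_rev.
by case/orP=> [/eqP->->//|/IH{}IH /IH ->]; rewrite orbT.
Qed.

Lemma tlen_tcount a col : tlen (tcount (es a) (estr col)) = count_mem a col.
Proof.
rewrite /tcount; set h := fun _ _ _ => _.
suff H acc : tlen (tfoldl h (es a) acc (estr col)) = count_mem a col + tlen acc.
  by rewrite H addn0.
elim: col acc => //= b col IH acc.
by rewrite IH /h tifE tlen_tneq_symbol eq_sym; case: eqP => _ /=; lia.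
Qed.

Definition plurality (col : seq Sigma) : Sigma :=
  foldl (fun b a => if count_mem a col <= count_mem b col then b else a)
    (head a0 col) col.

Lemma tplurality_enc col : tplurality (estr col) = es (plurality col).
Proof.
rewrite /tplurality hd_enc_string; apply: tfoldl_enc_seq => a xs b /=.
by rewrite tifE tlen_tsub !tlen_tcount subn_eq0; case: ifP.
Qed.

(** Along the fold the multiplicity of the current candidate never drops, and it dominates that of
    each symbol passed; symbols outside the column have multiplicity 0. *)
Lemma plurality_max col b : count_mem b col <= count_mem (plurality col) col.
Proof.
rewrite /plurality; set f := fun _ _ => _.
have foldl_ge s z a : (a \in s) || (a == z) ->
    count_mem a col <= count_mem (foldl f z s) col.
  elim: s z a => [|c s IH] z a /=; first by move/eqP->.
  have Hf : count_mem c col <= count_mem (f z c) col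
     /\ count_mem z col <= count_mem (f z c) col.
    by rewrite /f; case: ifP => [|/negbT]; rewrite -?ltnNge => H; split=> //; apply: ltnW.
  have H0 := IH (f z c) (f z c); rewrite eqxx orbT in H0.
  rewrite inE -orbA => /or3P[/eqP->|as_|/eqP->].
  - exact: leq_trans Hf.1 (H0 isT).
  - by apply: IH; rewrite as_.
  - exact: leq_trans Hf.2 (H0 isT).
have [bc|/count_memPn->//] := boolP (b \in col).
by apply: foldl_ge; rewrite bc.
Qed.

(** The reversal mirrors the accumulation in [tcolumn]; multiplicities are invariant under it. *)
Definition column (x : seq (seq Sigma)) (j : nat) : seq Sigma :=
  rev [seq nth a0 w j | w <- x].

Lemma tcolumn_enc c x : tcolumn c (efam x) = estr (column x (tlen c)).
Proof.
rewrite /tcolumn /column -[RHS]/(estr (rev _)) -[rev _]cats0 -[X in tfoldl _ _ X]/(estr [::]).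
elim: x [::] => [|w x IH] acc //=.
by rewrite tsub_enc_seq hd_enc_string -nth0 nth_drop addn0 -[Cons _ _]/(estr (_ :: acc)) IH
           rev_cons cat_rcons.
Qed.

Definition consensus m (x : seq (seq Sigma)) : m.-tuple Sigma :=
  [tuple plurality (column x j) | j < m].

Lemma tconsensus_enc c x : tconsensus c (efam x) = estr (consensus (tlen c) x).
Proof.
rewrite /tconsensus.
have -> : tval (consensus (tlen c) x) =
    mkseq (fun j => plurality (column x j)) (tlen c).
  by rewrite /= /mkseq -val_enum_ord -map_comp.
rewrite -[mkseq _ _]cats0 -[X in tfoldl _ _ X]/(estr [::]).
elim: c [::] => [|? _ c IH] acc //.
rewrite [tlen _]/= mkseqS cat_rcons -IH [LHS]/=.
by rewrite tcolumn_enc tplurality_enc.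
Qed.

Section Search.
Variables (t n m : nat) (Ss : t.-tuple (n.-tuple Sigma)) (W : seq (seq Sigma)).
Hypothesis m_gt0 : 0 < m.

Fixpoint search (k : nat) (x : seq (seq Sigma)) : m.-tuple Sigma :=
  if k is k'.+1 then
    foldl (fun u w => if cost Ss u <= cost Ss (search k' (w :: x)) then u
                      else search k' (w :: x)) (search k' x) W
  else consensus m x.

Lemma search_le k x w : w \in W ->
  cost Ss (search k.+1 x) <= cost Ss (search k (w :: x)).
Proof.
rewrite /=; set f := fun _ _ => _; move: (search k x) => z.
have fle u v : cost Ss (f u v) <= cost Ss u /\
    cost Ss (f u v) <= cost Ss (search k (v :: x)).
  by rewrite /f; case: ifP => [|/negbT]; rewrite -?ltnNge => H; split=> //; apply: ltnW.
have foldl_le s u : cost Ss (foldl f u s) <= cost Ss u.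
  by elim: s u => //= v s IH u; apply: leq_trans (IH _) (fle _ _).1.
elim: W z => //= v s IH z; rewrite inE => /orP[/eqP->|/IH//].
exact: leq_trans (foldl_le _ _) (fle _ _).2.
Qed.

Lemma tsearch_enc c k x : tlen c = m ->
  tsearch k (Cons (enc_family Ss) (Cons (efam W) c)) (efam x) = estr (search k x).
Proof.
move=> cm; elim: k x => [|k IH] x; first by rewrite /= tconsensus_enc cm.
rewrite /= IH.
apply: (@tfoldl_enc_seq _ _ estr (fun u : m.-tuple Sigma => estr u)) => w xs u /=.
rewrite -[Cons (estr w) _]/(efam (w :: x)) IH tifE tlen_tsub !tlen_tcost //.
by rewrite subn_eq0; case: ifP.
Qed.

End Search.

End Encoded.

(** * Quality of the sampled consensus *)

Local Open Scope ring_scope.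

Section Sampling.
Variables (R : realFieldType) (t : nat).
Hypothesis t_gt0 : (0 < t)%N.

Definition mean (f : 'I_t -> R) : R := t%:R^-1 * \sum_i f i.

(* The average of [f] over all ways of prepending k elements of ['I_t] to x. *)
Fixpoint avg (k : nat) (f : seq 'I_t -> R) (x : seq 'I_t) : R :=
  if k is k'.+1 then mean (fun i => avg k' f (i :: x)) else f x.

Let t_neq0 : t%:R != 0 :> R.
Proof. by rewrite pnatr_eq0 -lt0n. Qed.

Lemma eq_mean f g : f =1 g -> mean f = mean g.
Proof. by move=> fg; rewrite /mean (eq_bigr g). Qed.

Lemma mean_le f g : (forall i, f i <= g i) -> mean f <= mean g.
Proof. by move=> fg; rewrite ler_wpM2l ?invr_ge0 // ler_sum. Qed.

Lemma meanD f g : mean (fun i => f i + g i) = mean f + mean g.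
Proof. by rewrite /mean big_split mulrDr. Qed.

Lemma meanZ a f : mean (fun i => a * f i) = a * mean f.
Proof. by rewrite /mean -mulr_sumr mulrCA. Qed.

Lemma mean_const a : mean (fun=> a) = a.
Proof. by rewrite /mean sumr_const card_ord -[a *+ t]mulr_natl mulKf. Qed.

Lemma avg_le k f g x :
  (forall y, size y = (k + size x)%N -> f y <= g y) -> avg k f x <= avg k g x.
Proof.
elim: k x => [|k IH] x fg /=; first exact: fg.
by apply: mean_le => i; apply: IH => y sy; apply: fg; rewrite sy addnS.
Qed.

Lemma avgD k f g x : avg k (fun y => f y + g y) x = avg k f x + avg k g x.
Proof.
elim: k x => //= k IH x; rewrite -meanD; exact: eq_mean.
Qed.

Lemma avgZ k a f x : avg k (fun y => a * f y) x = a * avg k f x.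
Proof. elim: k x => //= k IH x; rewrite -meanZ; exact: eq_mean. Qed.

Lemma avg_const k a x : avg k (fun=> a) x = a.
Proof.
by elim: k x => //= k IH x; rewrite -[RHS]mean_const; apply: eq_mean.
Qed.

Lemma avg_sum (I : finType) k (f : I -> seq 'I_t -> R) x :
  avg k (fun y => \sum_a f a y) x = \sum_a avg k (f a) x.
Proof.
elim: k x => //= k IH x; rewrite (eq_mean (fun i => IH _)) /mean.
by rewrite exchange_big mulr_sumr.
Qed.

(** Variances of independent draws add up: the cross terms vanish because [Z] is centred. *)
Lemma avg_sqr_sum k (Z : 'I_t -> R) x : mean Z = 0 ->
  avg k (fun y => (\sum_(i <- y) Z i) ^+ 2) x =
    (\sum_(i <- x) Z i) ^+ 2 + k%:R * mean (fun i => Z i ^+ 2).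
Proof.
move=> Z0; elim: k x => [|k IH] x /=; first by rewrite mul0r addr0.
rewrite (eq_mean (fun i => IH _)) meanD mean_const.
set S := \sum_(i <- x) Z i; set V := mean (fun i => Z i ^+ 2).
have -> : mean (fun i => (\sum_(j <- i :: x) Z j) ^+ 2) = S ^+ 2 + V.
  rewrite (@eq_mean _ (fun i => Z i ^+ 2 + ((2 * S) * Z i + S ^+ 2))).
    by rewrite !meanD meanZ Z0 mean_const mulr0 add0r addrC.
  by move=> i; rewrite big_cons -/S; ring.
by rewrite -natr1; ring.
Qed.

(** * Plurality of a random sample in a single column *)

Section Column.
Variables (Sigma : finType) (c : 'I_t -> Sigma) (A : seq 'I_t -> Sigma).
Hypothesis A_plurality : forall x a,
  (count_mem a (map c x) <= count_mem (A x) (map c x))%N.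

Definition freq (a : Sigma) : R := mean (fun i => (c i == a)%:R).

Lemma freq_ge0 a : 0 <= freq a.
Proof. by rewrite -[X in X <= _](mean_const 0); apply: mean_le => i. Qed.

Lemma freq_le1 a : freq a <= 1.
Proof.
by rewrite -[X in _ <= X](mean_const 1); apply: mean_le => i; rewrite lern1 leq_b1.
Qed.

Lemma freqD_le1 a b : a != b -> freq a + freq b <= 1.
Proof.
move=> ab; rewrite -[X in _ <= X](mean_const 1) -meanD; apply: mean_le => i.
by rewrite -natrD lern1; case: (c i =P a) => [->|_]; rewrite ?(negbTE ab) ?leq_b1.
Qed.

(** The lead of [b] over [a] in one draw, centred. *)
Let diff a b (i : 'I_t) : R := (c i == b)%:R - (c i == a)%:R - (freq b - freq a).

Lemma mean_diff a b : mean (diff a b) = 0.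
Proof.
rewrite /diff meanD mean_const meanD.
rewrite (@eq_mean (fun i => - (c i == a)%:R) (fun i => (-1) * (c i == a)%:R)).
  by rewrite meanZ -/(freq a) -/(freq b); ring.
by move=> i; rewrite mulN1r.
Qed.

(** Put f = [freq b], p = [freq a] and q = 1 - f, so that p <= q. The variance is f (1 - f) + p + 2
    f p - p^2, where the first three terms are at most q, q and 2 q. *)
Lemma mean_diff_sqr a b : a != b ->
  mean (fun i => diff a b i ^+ 2) <= 4 * (1 - freq b).
Proof.
move=> ab; set d := freq b - freq a.
have -> : mean (fun i => diff a b i ^+ 2) = freq b + freq a - d ^+ 2.
  rewrite (@eq_mean _ (fun i => (1 - 2 * d) * (c i == b)%:R +
    ((1 + 2 * d) * (c i == a)%:R + d ^+ 2))).
    by rewrite !meanD !meanZ mean_const -/(freq a) -/(freq b) /d; ring.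
  move=> i; rewrite /diff -/d; case: (c i =P b) => [->|_].
    by rewrite eq_sym (negbTE ab) /=; ring.
  by case: eqP => _ /=; ring.
have := freqD_le1 ab; have := freq_ge0 a; have := freq_ge0 b.
rewrite /d; move: (freq a) (freq b) => p f; nra.
Qed.

Lemma sum_diff a b x : \sum_(i <- x) diff a b i =
  (count_mem b (map c x))%:R - (count_mem a (map c x))%:R
    - (size x)%:R * (freq b - freq a).
Proof.
elim: x => [|i x IH]; first by rewrite big_nil /=; ring.
by rewrite big_cons IH /= /diff !natrD -natr1; ring.
Qed.

(* A symbol a far less frequent than b wins the sample with small probability
   by Chebyshev's inequality, the variance of a single draw being O(1 - freq b);
   a symbol almost as frequent as b costs little more than b when it wins. *)
Lemma avg_plurality_cost s b : (1 < s)%N ->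
  avg (s ^ 2) (fun x => 1 - freq (A x)) [::] <=
    (1 + 4 * #|Sigma|%:R / s%:R) * (1 - freq b).
Proof.
move=> s1; set q := 1 - freq b.
have s2 : 2 <= s%:R :> R by rewrite ler_nat.
have s0 : 0 < s%:R :> R by apply: lt_le_trans s2.
have q0 : 0 <= q by rewrite subr_ge0 freq_le1.
set sv : R := s%:R^-1.
have sv0 : 0 < sv by rewrite invr_gt0.
have sv2 : sv <= 2^-1 by rewrite lef_pV2 ?posrE.
have ssv : s%:R * sv = 1 by rewrite divff ?gt_eqF.
pose d a := freq b - freq a.
pose r : R := (s ^ 2)%:R.
have rE : r = s%:R * s%:R by rewrite /r natrX expr2.
have r0 : 0 < r by rewrite rE mulr_gt0.
(* [D a x] dominates the excess [d a] whenever [a] wins the sample [x]. The threshold is 1 / s, for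
   sample size s^2. *)
pose D a x : R := if d a <= sv then 4 * sv * q
  else (r ^+ 2 * d a)^-1 * (\sum_(i <- x) diff a b i) ^+ 2.
have D0 a x : 0 <= D a x.
  rewrite /D; case: (leP (d a) sv) => ds; first by rewrite !mulr_ge0 // ltW.
  apply: mulr_ge0; last exact: sqr_ge0.
  rewrite invr_ge0; apply: mulr_ge0; first exact: sqr_ge0.
  exact: ltW (lt_trans sv0 ds).
have ab a : 0 < d a -> a != b.
  by apply: contraTN => /eqP->; rewrite /d subrr ltxx.
have dD x : size x = (s ^ 2)%N -> d (A x) <= D (A x) x.
  move=> sx; set a := A x; rewrite /D; case: (leP (d a) sv) => ds.
    have [da|da] := leP (d a) 0; first by rewrite (le_trans da) // !mulr_ge0 // ltW.
    (* Here [freq b - freq a <= 1/2] and [freq a + freq b <= 1], hence [freq b <= 3/4]. *)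
    have q4 : 1 <= 4 * q.
      by have := freqD_le1 (ab _ da); move: ds sv2; rewrite /q /d; lra.
    by apply: le_trans ds _; rewrite mulrAC ler_peMl // ltW.
  have da : 0 < d a by apply: lt_trans ds.
  rewrite sum_diff sx -/r -/(d a).
  (* If [a] wins, the centred sum is at most [- (r * d a)], so its square is at least
     [(r * d a) ^ 2]. *)
  have : (count_mem b (map c x))%:R <= (count_mem a (map c x))%:R :> R.
    by rewrite ler_nat A_plurality.
  move: (_%:R) (_%:R) => N M NM.
  rewrite mulrC ler_pdivlMr ?mulr_gt0 ?exprn_gt0 //.
  have : 0 <= r * d a by rewrite mulr_ge0 // ltW.
  by rewrite mulrCA -expr2 -exprMn; move: (r * d a) => e; nra.
have avg_Da a : avg (s ^ 2) (D a) [::] <= 4 * sv * q.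
  rewrite /D; case: (leP (d a) sv) => ds; first by rewrite avg_const.
  have da : 0 < d a by apply: lt_trans ds.
  rewrite avgZ (avg_sqr_sum _ _ (mean_diff a b)) big_nil expr0n add0r -/r.
  have := mean_diff_sqr (ab _ da); rewrite -/q; move: (mean _) => V HV.
  rewrite mulrC ler_pdivrMr ?mulr_gt0 ?exprn_gt0 //.
  (* The mean square of the sum is r V with V <= 4 q. Division by r^2 d leaves at most 4 q / (r d)
     <= 4 q / s, since s d >= 1. *)
  have -> : 4 * sv * q * (r ^+ 2 * d a) =
      r * (4 * q * ((s%:R * sv) * (s%:R * d a))) by rewrite rE; ring.
  rewrite ler_pM2l //; apply: le_trans HV _.
  rewrite ssv mul1r ler_peMr ?mulr_ge0 // -[X in X <= _]ssv ler_pM2l //; exact: ltW.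
(* Union bound: summing over all symbols removes the dependence on the winner and produces the
   factor [#|Sigma|]. *)
apply: (@le_trans _ _ (avg (s ^ 2) (fun x => q + \sum_a D a x) [::])).
  apply: avg_le => x; rewrite addn0 => sx.
  rewrite (bigD1 (A x)) //=.
  have : 0 <= \sum_(a | a != A x) D a x by apply: sumr_ge0.
  have := dD x sx; rewrite /q /d; lra.
rewrite avgD avg_const avg_sum.
have : \sum_a avg (s ^ 2) (D a) [::] <= \sum_(a : Sigma) 4 * sv * q.
  by apply: ler_sum.
rewrite sumr_const -[_ *+ #|_|]mulr_natl => H.
rewrite mulrDl mul1r lerD2l; apply: le_trans H _.
by rewrite le_eqVlt; apply/orP; left; apply/eqP; rewrite /sv; ring.
Qed.

End Column.

End Sampling.

(** * From single columns to the cost of the search *)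

Section Approximation.
Variables (R : realFieldType) (Sigma : finType) (a0 : Sigma).
Variables (t n m : nat) (Ss : t.-tuple (n.-tuple Sigma)) (W : seq (seq Sigma)).
Hypotheses (t_gt0 : (0 < t)%N) (m_gt0 : (0 < m)%N) (m_le_n : (m <= n)%N).
Hypothesis suffixes_W : forall i w, w \in suffixes (tnth Ss i) -> w \in W.

Lemma closest_suffix (v : m.-tuple Sigma) (i : 'I_t) :
  exists w, [/\ w \in W,
    forall u : m.-tuple Sigma,
      (dist_to_substrings u (tnth Ss i) <= mismatches a0 u w)%N &
    (mismatches a0 v w <= dist_to_substrings v (tnth Ss i))%N].
Proof.
set s := tnth Ss i.
have [y yi hy] : exists2 y : m.-tuple Sigma, infix y s &
    (hamming v y <= dist_to_substrings v s)%N.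
  rewrite /dist_to_substrings; elim/big_rec: _ => [|y z yi [y' y'i hy']].
    (* If the minimum is the default value m, the first m letters of [s] are a substring within that
       distance. *)
    have st : size (take m s) == m.
      by rewrite size_take_min size_tuple (minn_idPl m_le_n).
    exists (Tuple st); first by rewrite /= prefixW ?prefix_take.
    by rewrite -[X in (_ <= X)%N]card_ord /hamming max_card.
  by case: (leqP (hamming v y) z) => _; [exists y | exists y'].
have [s1 [s2 Es]] := infixP yi.
have pw : prefix y (y ++ s2) by rewrite prefix_prefix.
exists (y ++ s2); split.
- apply: (suffixes_W (i := i)); rewrite mem_suffixes -/s Es suffix_suffix andbT.
  by rewrite -size_eq0 size_cat size_tuple addn_eq0 negb_and -lt0n m_gt0.
- move=> u; rewrite -(hamming_mismatches a0 u pw).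
  exact: dist_to_substrings_le.
- by rewrite -(hamming_mismatches a0 v pw).
Qed.

Lemma search_cost s (v : m.-tuple Sigma) : (1 < s)%N ->
  (cost Ss (search a0 m Ss W (s ^ 2) [::]))%:R <=
    (1 + 4 * #|Sigma|%:R / s%:R) * (cost Ss v)%:R :> R.
Proof.
move=> s1.
have /fin_all_exists[w Hw] := closest_suffix v.
pose F x := cost Ss (consensus a0 m (map w x)).
(* The best choice at each level is no worse than a uniformly random one among the [w i]. *)
have search_avg k x :
    (cost Ss (search a0 m Ss W k (map w x)))%:R <= avg k (fun y => (F y)%:R) x :> R.
  elim: k x => [|k IH] x; first exact: lexx.
  rewrite -[X in X <= _](@mean_const _ _ t_gt0); apply: mean_le => i.
  apply: le_trans (IH (i :: x)); rewrite ler_nat search_le //.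
  by have [] := Hw i.
apply: le_trans (search_avg _ [::]) _.
pose c j i := nth a0 (w i) j.
pose A j x := plurality a0 (column a0 (map w x) j).
have A_pl j x a : (count_mem a (map (c j) x) <= count_mem (A j x) (map (c j) x))%N.
  have := plurality_max a0 (column a0 (map w x) j) a.
  by rewrite -/(A j x) /column !count_rev -map_comp.
have mean_neq j a : t%:R * (1 - freq R (c j) a) = \sum_i (a != c j i)%:R.
  rewrite /freq -[X in X - _](@mean_const R _ t_gt0).
  rewrite /mean -mulrBr mulrA divff ?pnatr_eq0 -?lt0n // mul1r.
  rewrite -sumrB; apply: eq_bigr => i _; rewrite eq_sym.
  by case: eqP => _; rewrite ?subrr ?subr0.
(* Double counting: the mismatches of [u] with all [w i] are counted by columns instead of by
   strings. *)
have col_sum (u : m.-tuple Sigma) : (\sum_i mismatches a0 u (w i))%:R =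
    \sum_(j < m) t%:R * (1 - freq R (c j) (tnth u j)).
  rewrite natr_sum (eq_bigr (fun j : 'I_m => \sum_i (tnth u j != c j i)%:R)).
    rewrite exchange_big; apply: eq_bigr => i _.
    rewrite /mismatches natr_sum size_tuple; apply: eq_bigr => j _.
    by rewrite (tnth_nth a0).
  by move=> j _; rewrite mean_neq.
apply: (@le_trans _ _ (avg (s ^ 2) (fun x =>
    \sum_(j < m) t%:R * (1 - freq R (c j) (A j x))) [::])).
  apply: avg_le => x _.
  apply: (@le_trans _ _ (\sum_i mismatches a0 (consensus a0 m (map w x)) (w i))%:R).
    by rewrite ler_nat leq_sum // => i _; have [_ H _] := Hw i; apply: H.
  rewrite col_sum le_eqVlt; apply/orP; left; apply/eqP.
  by apply: eq_bigr => j _; rewrite tnth_mktuple.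
rewrite avg_sum.
apply: (@le_trans _ _ (\sum_(j < m) t%:R * ((1 + 4 * #|Sigma|%:R / s%:R) *
    (1 - freq R (c j) (tnth v j))))).
  apply: ler_sum => j _; rewrite avgZ ler_wpM2l //.
  exact: avg_plurality_cost (A_pl j) _ _ s1.
rewrite (eq_bigr (fun j : 'I_m => (1 + 4 * #|Sigma|%:R / s%:R) *
    (t%:R * (1 - freq R (c j) (tnth v j))))); last by move=> j _; rewrite mulrCA.
rewrite -mulr_sumr -col_sum ler_wpM2l //.
  by rewrite addr_ge0 // divr_ge0 // mulr_ge0.
by rewrite ler_nat leq_sum // => i _; have [] := Hw i.
Qed.

End Approximation.

Lemma reopt_ptas (R : archiRealFieldType) (Sigma : finType) (alpha : R) :
  0 < alpha ->
  exists q : cmd,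
    (forall dom, poly_time_on dom q) /\
    forall (t n l : nat) (Ss : t.-tuple (n.-tuple Sigma)) (vopt : l.-tuple Sigma),
      (0 < t)%N -> (l.+1 <= n)%N ->
      exists v : (l.+1).-tuple Sigma,
        outputs q (reopt_input Ss vopt) (enc_string v) /\
        forall w : (l.+1).-tuple Sigma,
          (cost Ss v)%:R <= (1 + alpha) * (cost Ss w)%:R :> R.
Proof.
move=> a_gt0.
(* The bound makes the relative error 4 |Sigma| / s at most [alpha]; adding 2 ensures 1 < s. *)
pose s := (Num.bound (4 * #|Sigma|%:R / alpha)).+2.
have sP : 4 * #|Sigma|%:R / s%:R <= alpha.
  rewrite ler_pdivrMr ?ltr0n // [alpha * _]mulrC -ler_pdivrMr //.
  have H : 0 <= 4 * #|Sigma|%:R / alpha by rewrite divr_ge0 ?mulr_ge0 // ltW.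
  by apply: le_trans (ltW (archi_boundP H)) _; rewrite ler_nat ltnW.
have [q [qpoly qout]] := poly_fun_program (poly_tptas (s ^ 2)).
exists q; split=> // t n l Ss vopt t0 ln.
have n0 : (0 < n)%N by apply: leq_ltn_trans ln.
have S0 : (0 < #|Sigma|)%N.
  by apply/card_gt0P; exists (tnth (tnth Ss (Ordinal t0)) (Ordinal n0)).
pose a0 := enum_val (Ordinal S0).
have a0r : enum_rank a0 = 0%N :> nat by rewrite enum_valK.
have [W WE HW] := tsuffixes_enc Ss.
exists (search a0 l.+1 Ss W (s ^ 2) [::]); split.
  have cl : tlen (Cons Nil (enc_string vopt)) = l.+1.
    by rewrite /= tlen_enc_seq size_tuple.
  rewrite -(tsearch_enc a0r Ss W (ltn0Sn l) _ [::] cl) -WE.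
  exact: qout (reopt_input Ss vopt).
move=> w; apply: le_trans (search_cost R a0 t0 (ltn0Sn l) ln HW w (isT : 1 < s)%N) _.
by rewrite ler_wpM2r // lerD2l.
Qed.

(** * Reoptimization *)

(* Replaces the optimal string by its length plus one; the scratch variables 1
   and 2 are [Nil] again at the end, so that a program can be run next. *)
Definition reopt_to_csp : cmd :=
  Seq (Assign 1 (ETl (EVar 0))) (Seq (Assign 2 (ECons ENil ENil))
  (Seq (While (EVar 1)
          (Seq (Assign 2 (ECons ENil (EVar 2))) (Assign 1 (ETl (EVar 1)))))
  (Seq (Assign 0 (ECons (EHd (EVar 0)) (EVar 2))) (Assign 2 ENil)))).

Lemma exec_reopt_to_csp (T : Type) (enc : T -> tree) (F : tree) (v : seq T) :
  exec reopt_to_csp (init_store (Cons F (enc_seq enc v))) (10 * size v + 20)%N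
    (init_store (Cons F (enc_nat (size v).+1))).
Proof.
pose st (a b c : tree) : store :=
  update (update (update (fun=> Nil) 2 c) 1 b) 0 a.
have st_ext (s : store) a b c : s 0%N = a -> s 1%N = b -> s 2%N = c ->
    (forall x, s x.+3 = Nil) -> s = st a b c.
  (* Stores are functions, so the nested updates are brought to the normal form [st a b c] by
     extensionality. *)
  by move=> h0 h1 h2 h3; apply: funext => -[|[|[|x]]].
pose e := EVar 1.
pose body := Seq (Assign 2 (ECons ENil (EVar 2))) (Assign 1 (ETl (EVar 1))).
have loop a (w : seq T) k : exec (While e body) (st a (enc_seq enc w) (enc_nat k))
    (10 * size w + 2)%N (st a Nil (enc_nat (size w + k))).
  elim: w k => [|x w IH] k.
    exact: (@ExecWhileFalse (st a Nil (enc_nat k)) e).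
  have -> : (10 * size (x :: w) + 2 = (1 + 8 + (10 * size w + 2)).+1)%N.
    by rewrite /=; lia.
  apply: (@ExecWhileTrue _ (st a (enc_seq enc w) (enc_nat k.+1))) => //; last first.
    by have := IH k.+1; rewrite [(size w + _)%N]addnS.
  have E2 := @ExecAssign (st a (enc_seq enc (x :: w)) (enc_nat k)) 2
    (ECons ENil (EVar 2)).
  have E1 := @ExecAssign (update (st a (enc_seq enc (x :: w)) (enc_nat k)) 2
    (enc_nat k.+1)) 1 (ETl (EVar 1)).
  have := ExecSeq E2 E1.
  by rewrite [update _ 1 _](st_ext _ a (enc_seq enc w) (enc_nat k.+1)).
set x0 := Cons F _.
have E1 := @ExecAssign (init_store x0) 1 (ETl (EVar 0)).
rewrite [update _ 1 _](st_ext _ x0 (enc_seq enc v) Nil) // in E1.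
have E2 := @ExecAssign (st x0 (enc_seq enc v) Nil) 2 (ECons ENil ENil).
rewrite [update _ 2 _](st_ext _ x0 (enc_seq enc v) (enc_nat 1)) // in E2.
have E3 := loop x0 v 1%N.
rewrite addn1 in E3; set N := enc_nat (size v).+1 in E3 *.
have E4 := @ExecAssign (st x0 Nil N) 0 (ECons (EHd (EVar 0)) (EVar 2)).
rewrite [update _ 0 _](st_ext _ (Cons F N) Nil N) // in E4.
have E5 := @ExecAssign (st (Cons F N) Nil N) 2 ENil.
rewrite [update _ 2 _](st_ext _ (Cons F N) Nil Nil) // in E5.
have := ExecSeq E1 (ExecSeq E2 (ExecSeq E3 (ExecSeq E4 E5))).
rewrite -[st _ Nil Nil](st_ext (init_store (Cons F N))) //.
by congr exec; rewrite /=; lia.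
Qed.

Lemma tree_size_enc_nat k : tree_size (enc_nat k) = k.*2.+1.
Proof. by elim: k => //= k ->; rewrite doubleS. Qed.

(** Each entry contributes at least two to the size, so the length in unary is no larger than the
    encoded list. *)
Lemma size_le_tree_size (T : Type) (enc : T -> tree) (s : seq T) :
  ((size s).*2 < tree_size (enc_seq enc s))%N.
Proof. by elim: s => //= a s IH; have := tree_size_gt0 (enc a); lia. Qed.

Lemma reopt_from_csp (R : realType) (Sigma : finType) (p : cmd) :
  csp_approx_algorithm Sigma (1 : R) p ->
  poly_time_on (@is_reopt_input Sigma) (Seq reopt_to_csp p) /\
  forall (t n l : nat) (Ss : t.-tuple (n.-tuple Sigma)) (vopt : l.-tuple Sigma),
    (0 < t)%N -> (l.+1 <= n)%N ->
    exists v : (l.+1).-tuple Sigma,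
      outputs (Seq reopt_to_csp p) (reopt_input Ss vopt) (enc_string v) /\
      forall w : (l.+1).-tuple Sigma,
        optimal_closest_substring Ss w -> (cost Ss v <= cost Ss w)%N.
Proof.
move=> [[c [d pc]] papprox].
have run t n l (Ss : t.-tuple (n.-tuple Sigma)) (vopt : l.-tuple Sigma) k y :
    runs_in p (csp_input Ss l.+1) k y ->
    runs_in (Seq reopt_to_csp p) (reopt_input Ss vopt) (10 * l + 20 + k).+1 y.
  move=> [st E sty]; exists st => //.
  have := exec_reopt_to_csp (@enc_symbol Sigma) (enc_family Ss) vopt.
  by rewrite size_tuple => E0; apply: ExecSeq E0 E.
split; last first.
  move=> t n l Ss vopt t0 ln; have [v [[k Hk] Hv]] := papprox t n l.+1 Ss t0 ln.
  exists v; split; first by exists (10 * l + 20 + k).+1; apply: run.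
  by move=> w ow; have := Hv w ow; rewrite mul1r ler_nat.
(* Replacing the string by l + 1 in unary enlarges the input by at most 2, whence [N + 2]; the other
   summands pay for the conversion and the final [Seq]. *)
pose B (N : nat) := (10 * N + 21 + c * (N + 2) ^ d)%N.
have pB : pbound B.
  have pid := pbound_id; have pk := pbound_const.
  apply: pbound_add; first exact: pbound_add (pbound_mul (pk 10%N) pid) (pk _).
  apply: pbound_mul; first exact: pk.
  elim: d {pc B} => [|d IH]; first exact: pk.
  rewrite [fun _ => _](_ : _ = fun N => ((N + 2) * (N + 2) ^ d)%N).
    exact: pbound_mul (pbound_add pid (pk _)) IH.
  by apply: funext => N; rewrite expnS.
have [c' [d' HB]] := pbound_monomial pB.
exists c', d' => _ [t [n [l [Ss [vopt [t0 ln _ ->]]]]]].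
have [k [y [Hr Hk]]] : exists k y, runs_in p (csp_input Ss l.+1) k y /\
    (k <= c * tree_size (csp_input Ss l.+1) ^ d)%N.
  by apply: pc; exists t, n, l.+1, Ss.
exists (10 * l + 20 + k).+1, y; split; first exact: run.
apply: leq_trans (HB _ (tree_size_gt0 _)); rewrite /B.
set N := tree_size (reopt_input _ _).
have lv := size_le_tree_size (@enc_symbol Sigma) vopt.
rewrite size_tuple in lv.
have NE : N = (tree_size (enc_family Ss) +
  tree_size (enc_seq (@enc_symbol Sigma) vopt)).+1 by [].
have sN : (tree_size (csp_input Ss l.+1) <= N + 2)%N.
  rewrite -[tree_size _]/(tree_size (enc_family Ss) + tree_size (enc_nat l.+1)).+1.
  by rewrite tree_size_enc_nat; lia.
have lN : (l <= N)%N by lia.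
have : (k <= c * (N + 2) ^ d)%N.
  apply: leq_trans Hk _; rewrite leq_mul2l; apply/orP; right.
  by case: (d) => // d1; rewrite leq_exp2r.
by move: lN; lia.
Qed.

Theorem theorem3p2 (R : realType) (Sigma : finType) (sigma : R)
    (hsigma : 1 <= sigma) :
  (exists p : cmd, csp_approx_algorithm Sigma sigma p) ->
  exists q : cmd,
    poly_time_on (@is_reopt_input Sigma) q /\
    forall (t n l : nat) (Ss : t.-tuple (n.-tuple Sigma))
        (vopt : l.-tuple Sigma),
      (0 < t)%N -> (l.+1 <= n)%N -> optimal_closest_substring Ss vopt ->
      exists v'sol : (l.+1).-tuple Sigma,
        outputs q (reopt_input Ss vopt) (enc_string v'sol) /\
        forall v'opt : (l.+1).-tuple Sigma,
          optimal_closest_substring Ss v'opt ->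
          (cost Ss v'sol)%:R <=
            (2 * sigma - 1) / sigma * (cost Ss v'opt)%:R
            + (sigma - 1) / sigma * (t%:R - 1).
Proof.
move=> [p pP].
have [s1|s1] := leP sigma 1.
  have sE : sigma = 1 by apply/le_anti; rewrite s1 hsigma.
  rewrite sE in pP *; have [qpoly qP] := reopt_from_csp pP.
  exists (Seq reopt_to_csp p); split=> // t n l Ss vopt t0 ln _.
  have [v [vout vP]] := qP t n l Ss vopt t0 ln.
  exists v; split=> // w ow.
  have -> : 2 * 1 - 1 = 1 :> R by ring.
  by rewrite subrr !mul0r addr0 divr1 mul1r ler_nat; apply: vP.
have s0 : 0 < sigma := lt_trans ltr01 s1.
have a0 : 0 < (sigma - 1) / sigma by rewrite divr_gt0 // subr_gt0.
have [q [qpoly qP]] := reopt_ptas Sigma a0.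
exists q; split=> // t n l Ss vopt t0 ln _.
have [v [vout vP]] := qP t n l Ss vopt t0 ln.
exists v; split=> // w _; apply: le_trans (vP w) _.
have -> : (2 * sigma - 1) / sigma = 1 + (sigma - 1) / sigma.
  by field; rewrite gt_eqF.
(* The additive term is nonnegative because t >= 1. *)
by rewrite lerDl; apply: mulr_ge0; [exact: ltW | rewrite subr_ge0 ler1n].
Qed.
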